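(* Let $\hat\mu\in\operatorname{conv}\{g_1,\dots,g_N\}$ and run the MW–MMW rounds for the fixed center $\hat\mu$ with uniform initialization $w^{(1)}=(1/N,\dots,1/N)$, with $0<\eta_\rho\nu\le1/2$, $0<\eta_w\nu\le1/2$. Then $\bar S=S(\bar w;\hat\mu)$ and $$\|\bar S\|_{op}\le(1+\eta_\rho\nu)(1+\eta_w\nu)\,\mathrm{OPT}(\hat\mu)+\frac{(1+\eta_\rho\nu)\log\frac1{1-\epsilon}}{T\eta_w}+\frac{\log p}{T\eta_\rho}.$$ Consequently, if $\nu>0$, $\epsilon\in(0,1)$, $p\ge2$, and one chooses $$\eta_w=\frac1\nu\sqrt{\frac{\log\frac1{1-\epsilon}}{T}},\quad \eta_\rho=\frac1\nu\sqrt{\frac{\log p}{T}},\quad T\ge4\max\Big\{\log\tfrac1{1-\epsilon},\log p\Big\},$$ then $$\gamma(\bar w;\hat\mu)-\mathrm{OPT}(\hat\mu)\le 4\nu\left(\sqrt{\frac{\log\frac1{1-\epsilon}}{T}}+\sqrt{\frac{\log p}{T}}\right).$$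
   Context: Fix integers $N\ge1$, $p\ge1$, $\epsilon\in[0,1)$ and vectors $g_1,\dots,g_N\in\mathbb R^p$. The capped simplex is $\Delta_{N,\epsilon}=\{w\in\mathbb R^N:\sum_n w_n=1,\ 0\le w_n\le \frac{1}{(1-\epsilon)N}\}$; density matrices $\mathfrak D_p=\{\rho\in\mathbb R^{p\times p}:\rho=\rho^\top\succeq0,\mathrm{Tr}\,\rho=1\}$; $\langle A,B\rangle=\mathrm{Tr}(A^\top B)$. For a center $\hat\mu$ and $w\in\mathbb R^N$: $S(w;\hat\mu)=\sum_n w_n(g_n-\hat\mu)(g_n-\hat\mu)^\top$, $\gamma(w;\hat\mu)=\|S(w;\hat\mu)\|_{op}$, $\mathrm{OPT}(\hat\mu)=\min_{w\in\Delta_{N,\epsilon}}\max_{\rho\in\mathfrak D_p}\langle S(w;\hat\mu),\rho\rangle$; $\nu=\max_{i,j}\|g_i-g_j\|_2^2$. Relative entropy: $\mathrm{RE}(w\|v)=\sum_n w_n\log(w_n/v_n)$. MW–MMW rounds for a fixed center $\hat\mu$: $z_n=g_n-\hat\mu$, initial weights $w^{(1)}$, step sizes $\eta_w,\eta_\rho>0$, $T\ge1$. For $t=1,\dots,T$: $S^{(t)}=\sum_n w^{(t)}_n z_nz_n^\top$; $\rho^{(t)}=\exp(\eta_\rho\sum_{t'=1}^t S^{(t')})/\mathrm{Tr}\exp(\eta_\rho\sum_{t'=1}^tS^{(t')})$; $m^{(t)}_n=z_n^\top\rho^{(t)}z_n$; $\tilde w^{(t)}_n=w^{(t)}_n(1-\eta_w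 m^{(t)}_n)$; $w^{(t+1)}=\arg\min_{w\in\Delta_{N,\epsilon}}\mathrm{RE}(w\|\tilde w^{(t)})$. Outputs: $\bar w=\frac1T\sum_{t=1}^Tw^{(t)}$, $\bar S=\frac1T\sum_{t=1}^TS^{(t)}$. *)

(* Defs.v *)
From HB Require Import structures.
From mathcomp Require Import all_boot all_order all_algebra.
From mathcomp Require Import all_classical all_reals all_analysis.
Set Implicit Arguments. Unset Strict Implicit. Unset Printing Implicit Defensive.
Import Order.TTheory GRing.Theory Num.Theory.
Local Open Scope ring_scope.
Local Open Scope classical_set_scope.

Section MWDefs.
Variable R : realType.

Definition vnorm (p : nat) (x : 'cV[R]_p) : R :=
  Num.sqrt (\sum_(i < p) (x i ord0) ^+ 2).

Definition opnorm (p : nat) (A : 'M[R]_p) : R :=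
  sup [set vnorm (A *m x) | x in [set x : 'cV[R]_p | vnorm x = 1]].

Definition frob (p : nat) (A B : 'M[R]_p) : R := \tr (A^T *m B).

(* matrix powers (valid for any size p, including p = 0) *)
Definition mxpow (p : nat) (A : 'M[R]_p) (k : nat) : 'M[R]_p :=
  iter k (fun B => A *m B) 1%:M.

Definition expm (p : nat) (A : 'M[R]_p) : 'M[R]_p :=
  \matrix_(i, j) limn (fun n : nat => \sum_(k < n) (mxpow A k) i j / (k`!)%:R).

Definition capped_simplex (N : nat) (eps : R) : set ('I_N -> R) :=
  [set w | \sum_(n < N) w n = 1 /\
           forall n, 0 <= w n <= 1 / ((1 - eps) * N%:R)].

Definition density (p : nat) : set 'M[R]_p :=
  [set rho | rho^T = rho /\ (forall x : 'cV[R]_p, 0 <= (x^T *m rho *m x) ord0 ord0)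
             /\ \tr rho = 1].

Definition Smat (N p : nat) (g : 'I_N -> 'cV[R]_p) (mu : 'cV[R]_p) (w : 'I_N -> R)
  : 'M[R]_p := \sum_(n < N) w n *: ((g n - mu) *m (g n - mu)^T).

Definition gammaw (N p : nat) (g : 'I_N -> 'cV[R]_p) (mu : 'cV[R]_p) (w : 'I_N -> R) : R :=
  opnorm (Smat g mu w).

Definition OPT (N p : nat) (eps : R) (g : 'I_N -> 'cV[R]_p) (mu : 'cV[R]_p) : R :=
  inf [set sup [set frob (Smat g mu w) rho | rho in @density p]
      | w in @capped_simplex N eps].

Definition nu (N p : nat) (g : 'I_N -> 'cV[R]_p) : R :=
  \big[Num.max/0]_(i < N) \big[Num.max/0]_(j < N) (vnorm (g i - g j)) ^+ 2.

Definition in_conv (N p : nat) (g : 'I_N -> 'cV[R]_p) (mu : 'cV[R]_p) : Prop :=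
  exists lam : 'I_N -> R, (forall n, 0 <= lam n) /\ \sum_(n < N) lam n = 1 /\
    mu = \sum_(n < N) lam n *: g n.

Definition RE (N : nat) (w v : 'I_N -> R) : R :=
  \sum_(n < N) w n * ln (w n / v n).

Definition is_RE_proj (N : nat) (eps : R) (v u : 'I_N -> R) : Prop :=
  @capped_simplex N eps u /\ forall u', @capped_simplex N eps u' -> RE u v <= RE u' v.

(* The MW-MMW quantities for a weight sequence w : nat -> weights (rounds t = 1, 2, ...) *)
Definition S_t (N p : nat) (g : 'I_N -> 'cV[R]_p) (mu : 'cV[R]_p)
  (w : nat -> 'I_N -> R) (t : nat) : 'M[R]_p := Smat g mu (w t).

Definition rho_t (N p : nat) (g : 'I_N -> 'cV[R]_p) (mu : 'cV[R]_p) (eta_rho : R)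
  (w : nat -> 'I_N -> R) (t : nat) : 'M[R]_p :=
  let E := expm (eta_rho *: \sum_(1 <= t' < t.+1) S_t g mu w t') in
  (\tr E)^-1 *: E.

Definition m_t (N p : nat) (g : 'I_N -> 'cV[R]_p) (mu : 'cV[R]_p) (eta_rho : R)
  (w : nat -> 'I_N -> R) (t : nat) (n : 'I_N) : R :=
  (((g n - mu)^T *m rho_t g mu eta_rho w t) *m (g n - mu)) ord0 ord0.

Definition wtilde_t (N p : nat) (g : 'I_N -> 'cV[R]_p) (mu : 'cV[R]_p) (eta_w eta_rho : R)
  (w : nat -> 'I_N -> R) (t : nat) : 'I_N -> R :=
  fun n => w t n * (1 - eta_w * m_t g mu eta_rho w t n).

Definition MW_run (N p : nat) (eps : R) (g : 'I_N -> 'cV[R]_p) (mu : 'cV[R]_p)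
  (eta_w eta_rho : R) (T : nat) (w : nat -> 'I_N -> R) : Prop :=
  (forall n, w 1%N n = 1 / N%:R) /\
  forall t, (1 <= t <= T)%N ->
    is_RE_proj eps (wtilde_t g mu eta_w eta_rho w t) (w t.+1).

Definition wbar (N : nat) (T : nat) (w : nat -> 'I_N -> R) : 'I_N -> R :=
  fun n => T%:R^-1 * \sum_(1 <= t < T.+1) w t n.

Definition Sbar (N p : nat) (g : 'I_N -> 'cV[R]_p) (mu : 'cV[R]_p) (T : nat)
  (w : nat -> 'I_N -> R) : 'M[R]_p :=
  T%:R^-1 *: \sum_(1 <= t < T.+1) S_t g mu w t.

End MWDefs.

(* Main.v *)
Require Import Defs.
From HB Require Import structures.
From mathcomp Require Import all_boot all_order all_algebra.
From mathcomp Require Import all_classical all_reals all_analysis.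
From mathcomp Require Import spectral complex ring lra.
Import Order.TTheory GRing.Theory Num.Theory.
Import numFieldNormedType.Exports.
Local Open Scope ring_scope.

(** The matrix player is "be the leader": [rho_t] already sees [S_t]. Hence
    convexity of [A |-> ln (tr (exp A))] (Klein's inequality) telescopes to
      [eta_rho * T * lambda_max Sbar <= ln p + eta_rho * sum_t <S_t, rho_t>]
    with no second-order error and no Golden-Thompson inequality. For the weight
    player, the first-order optimality of the entropic projection (a Pythagorean
    inequality for [RE]) and [ln (1 - x) >= - x - x^2] give, for every [u] in the
    capped simplex,
      [eta_w * sum_t <S_t, rho_t>
         <= (1 + eta_w * nu) * eta_w * sum_t <S(u), rho_t> + RE(u || uniform)],
    where [RE(u || uniform) <= ln (1 / (1 - eps))]. Bounding [<S(u), rho_t>] by the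
    maximum over densities and taking the infimum over [u] yields the bound, even
    without the factors [1 + eta_rho * nu]. The second bound follows from
    [OPT <= nu]. *)

(** * Spectral theorem for real symmetric matrices *)

(** Over the complex extension the matrix is Hermitian, so its eigenvalues are real. Such a value is
    a root of a characteristic polynomial with real coefficients, so it already has an eigenvector
    over [R]. *)
Lemma symmetric_real_eigenvector (R : rcfType) (n : nat) (A : 'M[R]_n.+1) :
  A^T = A -> exists (a : R) (x : 'rV[R]_n.+1), x *m A = a *: x /\ x != 0.
Proof.
move=> symA; pose C := map_mx (real_complex R) A.
have hC : C \is hermsymmx.
  apply: realsym_hermsym.
    by apply/is_hermitianmxP; rewrite expr0 scale1r map_mx_id // /C map_trmx symA.
  by apply/mxOverP => i j; rewrite mxE; apply/complex_realP; exists (A i j).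
have /orthomx_spectralP := hermitian_normalmx hC.
have /mxOverP /(_ 0 0) := hermitian_spectral_diag_real hC.
set P := spectralmx C; set D := spectral_diag C => Dreal eqC.
have Pu : P \in unitmx by apply: spectral_unit.
have evC : eigenvalue C (D 0 0).
  apply/eigenvalueP; exists (row 0 P).
    rewrite -row_mul {1}eqC !mulmxA mulmxV // mul1mx row_mul row_diag_mx.
    by rewrite -scalemxAl -rowE.
  apply/eqP => P0; have : delta_mx 0 0 *m P *m invmx P = 0 :> 'rV_n.+1.
    by rewrite -rowE P0 mul0mx.
  rewrite mulmxK // => /matrixP /(_ 0 0); rewrite !mxE eqxx /=.
  by move/eqP; rewrite oner_eq0.
move: Dreal evC => /complex_realP [a ->].
rewrite eigenvalue_root_char -map_char_poly fmorph_root -eigenvalue_root_char.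
by case/eigenvalueP => x xA x0; exists a, x.
Qed.

Lemma row_mulmx_trE (R : pzSemiRingType) (n : nat) (x y : 'rV[R]_n) :
  (x *m y^T) 0 0 = \sum_i x 0 i * y 0 i.
Proof. by rewrite mxE; apply: eq_bigr => i _; rewrite mxE. Qed.

Lemma row_sqnorm_gt0 (R : realDomainType) (n : nat) (x : 'rV[R]_n) :
  x != 0 -> 0 < (x *m x^T) 0 0.
Proof.
move=> x0; rewrite row_mulmx_trE lt_def.
have sq_ge0 i : true -> 0 <= x 0 i * x 0 i by rewrite -expr2 sqr_ge0.
rewrite sumr_ge0 // andbT; apply: contra x0; rewrite psumr_eq0 // => /allP h.
apply/eqP/rowP => i; apply/eqP; rewrite mxE.
by have := h i (mem_index_enum i); rewrite mulf_eq0 orbb.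
Qed.

(* The Householder reflection exchanging [x] and the first basis vector. *)
Lemma unit_row_orthogonal_extension (R : realFieldType) (n : nat)
    (x : 'rV[R]_n.+1) : (x *m x^T) 0 0 = 1 ->
  exists H : 'M[R]_n.+1, H *m H^T = 1%:M /\ delta_mx 0 0 *m H = x.
Proof.
move=> x1; pose e : 'rV[R]_n.+1 := delta_mx 0 0.
have [->|xe] := eqVneq x e; first by exists 1%:M; rewrite trmx1 !mulmx1.
pose v := x - e; pose s : R := (v *m v^T) 0 0.
have s0 : s != 0 by rewrite gt_eqF // row_sqnorm_gt0 // subr_eq0.
have ey (y : 'rV[R]_n.+1) : (e *m y^T) 0 0 = y 0 0 by rewrite -rowE !mxE.
have xe' : (x *m e^T) 0 0 = x 0 0 by rewrite /e trmx_delta -colE mxE.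
(* As [x] and [e] are unit vectors, [s = 2 - 2 * x 0 0]. Hence the reflection along [v] sends [e] to
   [e + v], which is [x]. *)
have sE : s = - (v 0 0) *+ 2.
  have subE (M M' : 'M[R]_1) : (M - M') 0 0 = M 0 0 - M' 0 0 by rewrite !mxE.
  rewrite /s /v linearB /= mulmxBl !mulmxBr !subE x1 xe' !ey !mxE !eqxx /=.
  by ring.
pose H := 1%:M - (2 / s) *: (v^T *m v).
have HT : H^T = H by rewrite /H linearB /= linearZ /= trmx_mul trmxK trmx1.
exists H; split; last first.
  rewrite mulmxBr mulmx1 -scalemxAr mulmxA [e *m v^T]mx11_scalar ey mul_scalar_mx.
  rewrite scalerA sE.
  have v0 : v 0 0 != 0 by apply: contraNneq s0; rewrite sE => ->; rewrite oppr0 mul0rn.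
  have -> : 2 / (- v 0 0 *+ 2) * v 0 0 = -1 by field.
  by rewrite scaleN1r opprK addrC subrK.
have vv : (v^T *m v) *m (v^T *m v) = s *: (v^T *m v).
  by rewrite mulmxA -(mulmxA v^T v v^T) [v *m v^T]mx11_scalar -/s mul_mx_scalar
    -scalemxAl.
rewrite HT {2}/H mulmxBr mulmx1 /H mulmxBl mul1mx -scalemxAl -scalemxAr vv.
have cc : 2 / s * (2 / s) * s = 2 / s + 2 / s by field.
by rewrite !scalerA cc scalerDl opprB addrK subrK.
Qed.

(** Induction on the size: an orthogonal change of basis turns a unit eigenvector into the first
    basis vector. The first row is then diagonal, by symmetry so is the first column, and the
    remaining block is diagonalized recursively. *)
Lemma real_spectral (R : rcfType) (n : nat) (A : 'M[R]_n) : A^T = A ->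
  exists (U : 'M[R]_n) (d : 'rV[R]_n),
    U *m U^T = 1%:M /\ A = U^T *m diag_mx d *m U.
Proof.
elim: n A => [|n IHn] A symA; first by exists 0, 0; split; apply/matrixP => -[].
have [a [y [yA y0]]] := symmetric_real_eigenvector _ _ _ symA.
have yy := row_sqnorm_gt0 _ _ _ y0; set q := (y *m y^T) 0 0 in yy.
pose x := (Num.sqrt q)^-1 *: y.
have xA : x *m A = a *: x by rewrite -scalemxAl yA !scalerA mulrC.
have x1 : (x *m x^T) 0 0 = 1.
  rewrite linearZ /= -scalemxAl -scalemxAr scalerA mxE -/q -invfM -expr2.
  by rewrite sqr_sqrtr ?ltW // mulVf // gt_eqF.
have [H [HH eH]] := unit_row_orthogonal_extension _ _ _ x1.
have HH' := mulmx1C HH.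
have [B defB] : exists B : 'M[R]_(1 + n), B = H *m A *m H^T by eexists.
have symB : B^T = B by rewrite defB !trmx_mul trmxK symA mulmxA.
have rowB : delta_mx 0 0 *m B = a *: (delta_mx 0 0 : 'rV[R]_(1 + n)).
  by rewrite defB !mulmxA eH xA -eH -scalemxAl -mulmxA HH mulmx1.
have B0 j : B 0 j = a * (j == 0)%:R.
  by move: rowB; rewrite -rowE => /rowP /(_ j); rewrite !mxE.
have symB' : (drsubmx B)^T = drsubmx B by rewrite trmx_drsub symB.
have [V [d [VV eqV]]] := IHn _ symB'.
have BE : B = block_mx a%:M 0 0 (drsubmx B).
  rewrite -[LHS]submxK; congr block_mx.
  - apply/matrixP => i j; rewrite !ord1 !mxE !lshift0 B0 eqxx mulr1.
    by rewrite /= ?mulr1n.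
  - apply/matrixP => i j; rewrite ord1 !mxE lshift0 B0.
    by rewrite (_ : (rshift 1 j == 0) = false) ?mulr0.
  - apply/matrixP => i j; rewrite ord1 -symB !mxE lshift0 B0.
    by rewrite (_ : (rshift 1 i == 0) = false) ?mulr0.
pose W : 'M[R]_(1 + n) := block_mx 1%:M 0 0 V.
have WW : W *m W^T = 1%:M.
  rewrite /W tr_block_mx mulmx_block !trmx0 !mulmx0 !mul0mx trmx1 mulmx1.
  by rewrite VV !addr0 add0r -scalar_mx_block.
have DE : diag_mx (row_mx a%:M d) = block_mx a%:M 0 0 (diag_mx d).
  by rewrite diag_mx_row; congr block_mx; apply/matrixP => i j; rewrite !ord1 !mxE.
have BW : B = W^T *m diag_mx (row_mx a%:M d) *m W.
  rewrite BE eqV DE /W tr_block_mx !mulmx_block !trmx0 !mulmx0 !mul0mx trmx1.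
  by rewrite mulmx1 mul1mx !addr0 ?add0r !mul0mx.
exists (W *m H), (row_mx a%:M d); split.
  by rewrite trmx_mul mulmxA -(mulmxA W) HH mulmx1.
have -> : A = H^T *m B *m H by rewrite defB !mulmxA HH' mul1mx -mulmxA HH' mulmx1.
by rewrite BW trmx_mul !mulmxA.
Qed.

(** * Matrix exponential and traces in an orthogonal eigenbasis *)

Lemma conj_diag_mxE (R : pzSemiRingType) (p : nat) (U : 'M[R]_p) (d : 'rV[R]_p) i j :
  (U^T *m diag_mx d *m U) i j = \sum_l U l i * d 0 l * U l j.
Proof. by rewrite mul_mx_diag mxE; apply: eq_bigr => l _; rewrite !mxE. Qed.

Lemma mxpow_conj_diag (R : realType) (p : nat) (U : 'M[R]_p) (d : 'rV[R]_p) k :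
  U *m U^T = 1%:M ->
  mxpow (U^T *m diag_mx d *m U) k = U^T *m diag_mx (map_mx (fun x => x ^+ k) d) *m U.
Proof.
move=> UU; elim: k => [|k IHk] /=.
  rewrite (_ : map_mx _ d = const_mx 1).
    by rewrite diag_const_mx mulmx1 (mulmx1C UU).
  by apply/rowP => i; rewrite !mxE expr0.
rewrite -/(mxpow _ k) IHk !mulmxA -(mulmxA _ U U^T) UU mulmx1 -(mulmxA U^T).
congr (_ *m _ *m _); rewrite mulmx_diag; congr diag_mx.
by apply/rowP => i; rewrite !mxE exprS.
Qed.

(** Each entry of a partial sum is a fixed finite combination, over the eigenvalues, of partial sums
    of the scalar exponential series, so the entrywise limit can be taken term by term. *)
Lemma expm_conj_diag (R : realType) (p : nat) (U : 'M[R]_p) (d : 'rV[R]_p) :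
  U *m U^T = 1%:M ->
  expm (U^T *m diag_mx d *m U) = U^T *m diag_mx (map_mx expR d) *m U.
Proof.
move=> UU; apply/matrixP => i j; rewrite conj_diag_mxE mxE.
rewrite (_ : (fun n => _) =
    (fun n => \sum_l U l i * U l j * series (exp_coeff (d 0 l)) n)); last first.
  apply/funext => n; rewrite /series /=.
  under eq_bigr do rewrite mxpow_conj_diag // conj_diag_mxE mulr_suml.
  rewrite exchange_big /=; apply: eq_bigr => l _.
  rewrite big_mkord mulr_sumr; apply: eq_bigr => k _.
  by rewrite /exp_coeff /= mxE; ring.
rewrite (_ : \sum_l _ = \sum_l U l i * U l j * expR (d 0 l)); last first.
  by apply: eq_bigr => l _; rewrite mxE; ring.
apply: (cvg_lim (@Rhausdorff R)).
apply: cvg_big => [|l _]; first exact: add_continuous.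
by apply: cvgMl_tmp; exact: is_cvg_series_exp_coeff.
Qed.

Lemma mxtrace_conj_diag (R : comPzRingType) (p : nat) (U : 'M[R]_p) (d : 'rV[R]_p) :
  U *m U^T = 1%:M -> \tr (U^T *m diag_mx d *m U) = \sum_i d 0 i.
Proof. by move=> UU; rewrite mxtrace_mulC mulmxA UU mul1mx mxtrace_diag. Qed.

(** For orthogonal [U] and [V] the squared entries of [U *m V^T] are doubly stochastic weights on
    pairs of eigenvalues. Trace inequalities thus become averages of scalar ones. *)
Lemma mxtrace_mul_conj_diag (R : comPzRingType) (p : nat) (U V : 'M[R]_p)
    (d f : 'rV[R]_p) :
  \tr ((U^T *m diag_mx d *m U) *m (V^T *m diag_mx f *m V)) =
  \sum_i \sum_j (U *m V^T) i j ^+ 2 * (d 0 i * f 0 j).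
Proof.
rewrite -!mulmxA mxtrace_mulC !mulmxA -(mulmxA _ U V^T) -(mulmxA _ V U^T).
have -> : V *m U^T = (U *m V^T)^T by rewrite trmx_mul trmxK.
set C := U *m V^T; rewrite mul_diag_mx mul_mx_diag /mxtrace.
apply: eq_bigr => i _; rewrite mxE; apply: eq_bigr => j _.
by rewrite !mxE; ring.
Qed.

Lemma orthogonal_sqr_row_sum (R : comPzRingType) (p : nat) (C : 'M[R]_p) i :
  C *m C^T = 1%:M -> \sum_j C i j ^+ 2 = 1.
Proof.
move=> /matrixP /(_ i i); rewrite !mxE eqxx => h.
by apply: etrans h; apply: eq_bigr => j _; rewrite mxE expr2.
Qed.

Lemma orthogonal_sqr_col_sum (R : comPzRingType) (p : nat) (C : 'M[R]_p) j :
  C *m C^T = 1%:M -> \sum_i C i j ^+ 2 = 1.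
Proof.
move=> /mulmx1C CC; rewrite -[RHS](@orthogonal_sqr_row_sum _ _ C^T j) ?trmxK //.
by apply: eq_bigr => i _; rewrite mxE.
Qed.

Lemma mxtrace_expm_gt0 (R : realType) (p : nat) (A : 'M[R]_p) :
  (0 < p)%N -> A^T = A -> 0 < \tr (expm A).
Proof.
case: p A => // p A _ /real_spectral [U [d [UU ->]]].
rewrite expm_conj_diag // mxtrace_conj_diag // big_ord_recl ltr_pwDl //.
  by rewrite mxE expR_gt0.
by apply: sumr_ge0 => i _; rewrite mxE expR_ge0.
Qed.

(* Klein's inequality applied to [A] and [B + c], where [c] is the constant for
   which both exponentials have the same trace. *)
Lemma ln_mxtrace_expm_gradient (R : realType) (p : nat) (A B : 'M[R]_p) :
  (0 < p)%N -> A^T = A -> B^T = B ->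
  \tr ((A - B) *m expm B) / \tr (expm B) <=
  ln (\tr (expm A)) - ln (\tr (expm B)).
Proof.
move=> p0 sA sB.
have ZA0 := mxtrace_expm_gt0 _ _ _ p0 sA; have ZB0 := mxtrace_expm_gt0 _ _ _ p0 sB.
set ZA := \tr (expm A) in ZA0 *; set ZB := \tr (expm B) in ZB0 *.
pose c := ln ZA - ln ZB.
have ec : expR c = ZA / ZB by rewrite /c expRB !lnK.
(* Since [expR c * ZB = ZA], this amounts to [\tr ((A - B) *m expm B) <= c * ZB]. *)
suff: expR c * (ZB + \tr ((A - B) *m expm B) - c * ZB) <= ZA.
  rewrite ec -/c -mulrA -[X in _ <= X]mulr1 ler_pM2l // ler_pdivrMl // mulr1.
  by rewrite ler_pdivrMr // => h; lra.
have [U [a [UU eA]]] := real_spectral _ _ _ sA.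
have [V [b [VV eB]]] := real_spectral _ _ _ sB.
rewrite mulmxBl linearB /= /ZA /ZB eA eB !expm_conj_diag // !mxtrace_conj_diag //.
rewrite !mxtrace_mul_conj_diag.
have -> : \sum_i \sum_j (V *m V^T) i j ^+ 2 * (b 0 i * map_mx expR b 0 j) =
    \sum_j b 0 j * expR (b 0 j).
  apply: eq_bigr => i _; rewrite VV (bigD1 i) //= !mxE eqxx expr1n mul1r.
  by rewrite big1 ?addr0 // => j ji; rewrite mxE eq_sym (negPf ji) expr0n mul0r.
set C := U *m V^T.
have CC : C *m C^T = 1%:M.
  by rewrite /C trmx_mul trmxK mulmxA -(mulmxA U) (mulmx1C VV) mulmx1.
clearbody C.
(* Row and column sums of [C i j ^+ 2] equal one, so a sum over either spectrum spreads over all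
   pairs and the claim reduces to one scalar inequality per pair. *)
have splitR (F : 'I_p -> R) : \sum_j F j = \sum_i \sum_j C i j ^+ 2 * F j.
  rewrite exchange_big; apply: eq_bigr => j _.
  by rewrite -mulr_suml orthogonal_sqr_col_sum // mul1r.
have splitL (F : 'I_p -> R) : \sum_i F i = \sum_i \sum_j C i j ^+ 2 * F i.
  by apply: eq_bigr => i _; rewrite -mulr_suml orthogonal_sqr_row_sum // mul1r.
rewrite [X in _ <= X]splitL (splitR (fun j => map_mx expR b 0 j)).
rewrite (splitR (fun j => _ * _)) -sumrB mulr_sumr -big_split -sumrB /= mulr_sumr.
apply: ler_sum => i _; rewrite -sumrB mulr_sumr -big_split -sumrB /= mulr_sumr.
apply: ler_sum => j _; rewrite !mxE.
(* The exponential lies above its tangent at [c + b 0 j]. *)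
have h : expR c * expR (b 0 j) * (1 + (a 0 i - b 0 j - c)) <= expR (a 0 i).
  rewrite -expRD [X in _ <= X](_ : _ = expR (c + b 0 j) * expR (a 0 i - b 0 j - c)).
    by rewrite ler_pM2l ?expR_gt0 // expR_ge1Dx.
  by rewrite -expRD; congr expR; ring.
apply: le_trans (ler_wpM2l (sqr_ge0 (C i j)) h).
by rewrite le_eqVlt; apply/orP; left; apply/eqP; ring.
Qed.

(** * Norms, quadratic forms and density matrices *)

Lemma sqr_vnorm (R : realType) (p : nat) (x : 'cV[R]_p) :
  vnorm x ^+ 2 = \sum_i x i ord0 ^+ 2.
Proof. by rewrite sqr_sqrtr // sumr_ge0 // => i _; rewrite sqr_ge0. Qed.

Lemma vnorm_ge0 (R : realType) (p : nat) (x : 'cV[R]_p) : 0 <= vnorm x.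
Proof. exact: sqrtr_ge0. Qed.

Lemma sqr_vnorm_tr (R : realType) (p : nat) (x : 'cV[R]_p) :
  vnorm x ^+ 2 = (x^T *m x) ord0 ord0.
Proof. by rewrite sqr_vnorm mxE; apply: eq_bigr => i _; rewrite mxE expr2. Qed.

Lemma vnorm_orthogonal (R : realType) (p : nat) (U : 'M[R]_p) (x : 'cV[R]_p) :
  U^T *m U = 1%:M -> vnorm (U *m x) = vnorm x.
Proof.
move=> UU; apply/eqP; rewrite -(eqrXn2 (n := 2)) ?vnorm_ge0 // !sqr_vnorm_tr.
by rewrite trmx_mul mulmxA -(mulmxA x^T) UU mulmx1.
Qed.

Lemma quad_conj_diag (R : realType) (p : nat) (U : 'M[R]_p) (d : 'rV[R]_p)
    (x : 'cV[R]_p) :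
  (x^T *m (U^T *m diag_mx d *m U) *m x) ord0 ord0 =
  \sum_i d 0 i * (U *m x) i ord0 ^+ 2.
Proof.
rewrite !mulmxA -trmx_mul -(mulmxA _ U x) mul_mx_diag.
move: (U *m x) => y; rewrite mxE; apply: eq_bigr => i _; rewrite !mxE; ring.
Qed.

Lemma psd_spectral_diag_ge0 (R : realType) (p : nat) (U : 'M[R]_p) (d : 'rV[R]_p) i :
  U *m U^T = 1%:M ->
  (forall x : 'cV[R]_p, 0 <= (x^T *m (U^T *m diag_mx d *m U) *m x) ord0 ord0) ->
  0 <= d 0 i.
Proof.
move=> UU /(_ (U^T *m delta_mx i 0)).
rewrite quad_conj_diag mulmxA UU mul1mx (bigD1 i) //= big1 => [|j ji].
  by rewrite mxE !eqxx expr1n mulr1 addr0.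
by rewrite mxE (negPf ji) expr0n mulr0.
Qed.

(** The eigenvalues of a density matrix are nonnegative with sum one, so each is at most one. *)
Lemma density_quad_le (R : realType) (p : nat) (rho : 'M[R]_p) (x : 'cV[R]_p) :
  density rho -> (x^T *m rho *m x) ord0 ord0 <= vnorm x ^+ 2.
Proof.
case=> /real_spectral [U [d [UU ->]]] [psd]; rewrite mxtrace_conj_diag // => d1.
have d0 i := psd_spectral_diag_ge0 _ _ _ _ i UU psd.
rewrite quad_conj_diag -(vnorm_orthogonal _ _ U) ?(mulmx1C UU) // sqr_vnorm.
apply: ler_sum => i _; rewrite ler_piMl ?sqr_ge0 // -d1 (bigD1 i) //=.
by rewrite lerDl sumr_ge0.
Qed.

Lemma gibbs_density (R : realType) (p : nat) (A : 'M[R]_p) :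
  (0 < p)%N -> A^T = A -> density ((\tr (expm A))^-1 *: expm A).
Proof.
move=> p0 sA; have Z0 := mxtrace_expm_gt0 _ _ _ p0 sA.
have [U [d [UU eA]]] := real_spectral _ _ _ sA; split; last split.
- rewrite linearZ /= eA expm_conj_diag // !trmx_mul trmxK tr_diag_mx.
  by rewrite mulmxA.
- move=> x; rewrite -scalemxAr -scalemxAl mxE mulr_ge0 ?invr_ge0 ?(ltW Z0) //.
  rewrite {1}eA expm_conj_diag // quad_conj_diag sumr_ge0 // => i _.
  by rewrite mulr_ge0 ?sqr_ge0 // mxE expR_ge0.
- by rewrite mxtraceZ mulVf // gt_eqF.
Qed.

(** For positive semidefinite [A] the operator norm is governed by the largest eigenvalue, and the
    exponential of every eigenvalue is one of the positive terms of [\tr (expm A)]. *)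
Lemma opnorm_le_ln_mxtrace_expm (R : realType) (p : nat) (c : R) (A : 'M[R]_p) :
  (0 < p)%N -> A^T = A -> 0 <= c ->
  (forall x : 'cV[R]_p, 0 <= (x^T *m A *m x) ord0 ord0) ->
  opnorm (c *: A) <= c * ln (\tr (expm A)).
Proof.
move=> p0 sA c0 psd; have Z0 := mxtrace_expm_gt0 _ _ _ p0 sA.
have [U [d [UU eA]]] := real_spectral _ _ _ sA.
have d0 i : 0 <= d 0 i.
  by apply: (psd_spectral_diag_ge0 _ _ U) => // x; rewrite -eA.
have dM i : d 0 i <= ln (\tr (expm A)).
  rewrite -[X in X <= _]expRK ler_ln ?posrE ?expR_gt0 //.
  rewrite eA expm_conj_diag // mxtrace_conj_diag // (bigD1 i) //= mxE lerDl.
  by apply: sumr_ge0 => j _; rewrite mxE expR_ge0.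
have M0 : 0 <= ln (\tr (expm A)) := le_trans (d0 (Ordinal p0)) (dM _).
apply: ge_sup.
  exists (vnorm ((c *: A) *m delta_mx (Ordinal p0) 0)),
    (delta_mx (Ordinal p0) 0) => //=.
  rewrite /vnorm (bigD1 (Ordinal p0)) //= big1 => [|j ji].
    by rewrite mxE !eqxx expr1n addr0 sqrtr1.
  by rewrite mxE (negPf ji) expr0n.
move=> _ [x /= x1 <-].
rewrite -(ler_pXn2r (n := 2)) ?nnegrE ?vnorm_ge0 ?mulr_ge0 // -scalemxAl.
rewrite sqr_vnorm exprMn.
have -> : \sum_i (c *: (A *m x)) i ord0 ^+ 2 = c ^+ 2 * vnorm (A *m x) ^+ 2.
  by rewrite sqr_vnorm mulr_sumr; apply: eq_bigr => i _; rewrite mxE exprMn.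
rewrite ler_wpM2l ?sqr_ge0 // {1}eA -!mulmxA vnorm_orthogonal ?trmxK // mul_diag_mx.
rewrite -[X in _ <= X]mulr1 -[X in _ * X](expr1n _ 2) -[X in _ * X ^+ _]x1.
rewrite -(vnorm_orthogonal _ _ U x) ?(mulmx1C UU) // !sqr_vnorm mulr_sumr.
apply: ler_sum => i _; rewrite mxE exprMn ler_wpM2r ?sqr_ge0 //.
by rewrite ler_pXn2r ?nnegrE.
Qed.

(** * The weighted scatter matrix and the diameter bound *)

Lemma frob_Smat (R : realType) (N p : nat) (g : 'I_N -> 'cV[R]_p) (mu : 'cV[R]_p)
    (w : 'I_N -> R) (rho : 'M[R]_p) :
  frob (Smat g mu w) rho =
  \sum_n w n * ((g n - mu)^T *m rho *m (g n - mu)) ord0 ord0.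
Proof.
rewrite /frob /Smat linear_sum mulmx_suml linear_sum /=; apply: eq_bigr => n _.
rewrite linearZ /= -scalemxAl mxtraceZ; congr (_ * _).
by rewrite trmx_mul trmxK mxtrace_mulC mulmxA mxtrace_mulC mulmxA /mxtrace big_ord1.
Qed.

Lemma Smat_sym (R : realType) (N p : nat) (g : 'I_N -> 'cV[R]_p) (mu : 'cV[R]_p)
    (w : 'I_N -> R) : (Smat g mu w)^T = Smat g mu w.
Proof.
rewrite /Smat linear_sum /=; apply: eq_bigr => n _.
by rewrite linearZ /= trmx_mul trmxK.
Qed.

Lemma Smat_quad_ge0 (R : realType) (N p : nat) (g : 'I_N -> 'cV[R]_p)
    (mu : 'cV[R]_p) (w : 'I_N -> R) (x : 'cV[R]_p) :
  (forall n, 0 <= w n) -> 0 <= (x^T *m Smat g mu w *m x) ord0 ord0.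
Proof.
move=> w0; rewrite /Smat mulmx_sumr mulmx_suml summxE sumr_ge0 // => n _.
rewrite -scalemxAr -scalemxAl mxE mulr_ge0 //.
set z := g n - mu; rewrite mulmxA -(mulmxA _ z^T x).
set y := z^T *m x; have -> : x^T *m z = y^T by rewrite /y trmx_mul trmxK.
by rewrite -sqr_vnorm_tr sqr_ge0.
Qed.

(** The weighted variance of [a] is nonnegative. *)
Lemma sqr_wmean_le (R : realDomainType) (I : finType) (lam a : I -> R) :
  (forall i, 0 <= lam i) -> \sum_i lam i = 1 ->
  (\sum_i lam i * a i) ^+ 2 <= \sum_i lam i * a i ^+ 2.
Proof.
move=> l0 l1; have [m defm] : exists m, m = \sum_i lam i * a i by eexists.
rewrite -defm.
have : 0 <= \sum_i lam i * (a i - m) ^+ 2.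
  by apply: sumr_ge0 => i _; rewrite mulr_ge0 ?sqr_ge0.
have -> : \sum_i lam i * (a i - m) ^+ 2 =
    \sum_i lam i * a i ^+ 2 - 2 * m * (\sum_i lam i * a i) + m ^+ 2 * \sum_i lam i.
  rewrite !mulr_sumr -sumrB -big_split; apply: eq_bigr => i _ /=; ring.
by rewrite -defm l1 => h; lra.
Qed.

Lemma nu_ge (R : realType) (N p : nat) (g : 'I_N -> 'cV[R]_p) i j :
  vnorm (g i - g j) ^+ 2 <= nu g.
Proof.
apply: le_trans (le_bigmax 0 (fun i => \big[Num.max/0]_j vnorm (g i - g j) ^+ 2) i).
exact: (le_bigmax 0 (fun j => vnorm (g i - g j) ^+ 2) j).
Qed.

Lemma nu_ge0 (R : realType) (N p : nat) (g : 'I_N -> 'cV[R]_p) : 0 <= nu g.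
Proof. exact: bigmax_ge_id. Qed.

(** The squared distance to [g n] is convex, so at a point of the hull it is at most an average of
    squared pairwise distances. Convexity is checked coordinate by coordinate. *)
Lemma sqr_dist_conv_le_nu (R : realType) (N p : nat) (g : 'I_N -> 'cV[R]_p)
    (mu : 'cV[R]_p) n : in_conv g mu -> vnorm (g n - mu) ^+ 2 <= nu g.
Proof.
case=> lam [l0 [l1 ->]].
have -> : g n - \sum_j lam j *: g j = \sum_j lam j *: (g n - g j).
  rewrite -[g n in LHS]scale1r -l1 scaler_suml -sumrB.
  by apply: eq_bigr => j _; rewrite scalerBr.
apply: (@le_trans _ _ (\sum_j lam j * vnorm (g n - g j) ^+ 2)); last first.
  rewrite -[X in _ <= X]mul1r -l1 mulr_suml; apply: ler_sum => j _.
  by rewrite ler_wpM2l ?nu_ge.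
rewrite sqr_vnorm; under [X in _ <= X]eq_bigr do rewrite sqr_vnorm mulr_sumr.
rewrite exchange_big /=; apply: ler_sum => k _.
rewrite summxE (eq_bigr (fun j => lam j * (g n - g j) k ord0)).
  exact: sqr_wmean_le.
by move=> j _; rewrite [LHS]mxE.
Qed.

(** * Scalar inequalities for [expR] and [ln] *)

Lemma ln_le_subr1 (R : realType) (x : R) : 0 < x -> ln x <= x - 1.
Proof.
move=> x0; have := @le_ln1Dx R (x - 1); rewrite [1 + _]addrC subrK; apply; lra.
Qed.

Lemma expR_ge1DxDsqr (R : realType) (x : R) : 0 <= x -> 1 + x + x ^+ 2 / 2 <= expR x.
Proof.
move=> x0.
have : series (exp_coeff x) 3 <= expR x.
  apply: nondecreasing_cvgn_le; last exact: is_cvg_series_exp_coeff.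
  by apply: nondecreasing_series => n _ _; exact: exp_coeff_ge0.
rewrite /series /= !big_nat_recr //= big_nil /exp_coeff /= add0r.
by rewrite expr0 expr1 !fact0 divr1 factS !divr1.
Qed.

Lemma ln1Bx_ge (R : realType) (x : R) :
  0 <= x <= 1 / 2 -> - (x + x ^+ 2) <= ln (1 - x).
Proof.
move=> /andP[x0 x1]; rewrite -[X in X <= _]expRK.
rewrite ler_ln ?posrE ?expR_gt0 ?subr_gt0 //; [|lra].
have y0 : 0 <= x + x ^+ 2 by rewrite addr_ge0 ?sqr_ge0.
rewrite expRN -[X in _ <= X]invrK lef_pV2 ?posrE ?invr_gt0 ?expR_gt0 //; [|lra].
apply: le_trans (expR_ge1DxDsqr _ _ y0).
rewrite -[X in X <= _]mul1r ler_pdivrMr; [|lra].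
(* With [y = x + x ^+ 2], the product of [1 + y + y ^+ 2 / 2] and [1 - x] exceeds 1 by half of
   [x ^+ 2 - x ^+ 3 - x ^+ 4 - x ^+ 5], which is the sum of the quantities in [h1] and [h2]. *)
have h1 : 0 <= (1 - 2 * x) * x ^+ 2 by rewrite mulr_ge0 ?sqr_ge0 //; lra.
have h2 : 0 <= (1 - x - x ^+ 2) * x ^+ 3.
  by rewrite mulr_ge0 ?exprn_ge0 //; nra.
lra.
Qed.

(** The left side is the tangent at [b] of the convex function [a |-> a * ln (a / v)]; the
    inequality persists at the boundary point [a = 0]. *)
Lemma entropy_tangent (R : realType) (a b v : R) : 0 <= a -> 0 < b -> 0 < v ->
  a * ln (b / v) + (a - b) <= a * ln (a / v).
Proof.
rewrite le_eqVlt => /predU1P[<-|a0] b0 v0; first by rewrite !mul0r; lra.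
have := ln_le_subr1 _ (b / a) (divr_gt0 b0 a0).
rewrite !ln_div ?posrE // => /(ler_wpM2l (ltW a0)).
by rewrite mulrBr mulrBr [a * (b / a)]mulrC divfK ?gt_eqF // mulrBr; lra.
Qed.

(** * The entropic projection onto the capped simplex *)

Lemma capped_simplex_convex (R : realType) (N : nat) (eps s : R) (q u : 'I_N -> R) :
  0 <= s <= 1 -> capped_simplex eps q -> capped_simplex eps u ->
  capped_simplex eps (fun n => q n + s * (u n - q n)).
Proof.
move=> /andP[s0 s1] [q1 qb] [u1 ub]; split.
  by rewrite big_split -mulr_sumr sumrB /= q1 u1 subrr mulr0 addr0.
move=> n; have /andP[q0 qM] := qb n; have /andP[u0 uM] := ub n.
have -> : q n + s * (u n - q n) = (1 - s) * q n + s * u n by ring.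
set M := 1 / _ in qM uM *; apply/andP; split.
  by rewrite addr_ge0 ?mulr_ge0 // subr_ge0.
have -> : M = (1 - s) * M + s * M by ring.
by rewrite lerD ?ler_wpM2l // subr_ge0.
Qed.

Lemma uniform_capped_simplex (R : realType) (N : nat) (eps : R) :
  (1 <= N)%N -> 0 <= eps < 1 -> capped_simplex eps (fun _ : 'I_N => 1 / N%:R).
Proof.
move=> N1 /andP[e0 e1]; have N0 : 0 < N%:R :> R by rewrite ltr0n.
split => [|_]; first by rewrite sumr_const card_ord -[LHS]mulr_natr divfK ?gt_eqF.
apply/andP; split; first by rewrite divr_ge0 ?ler01 ?ler0n.
rewrite !div1r lef_pV2 ?posrE ?mulr_gt0 ?subr_gt0 //.
by rewrite ler_piMl ?ler0n //; lra.
Qed.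

(* Convexity bounds [RE] at the segment point by its tangent there, so no
   derivative at the possibly degenerate endpoint [q] is needed. *)
Lemma RE_proj_segment (R : realType) (N : nat) (eps s : R) (v q u : 'I_N -> R) :
  (forall n, 0 < v n) -> is_RE_proj eps v q -> capped_simplex eps u ->
  0 < s <= 1 -> (forall n, 0 < q n + s * (u n - q n)) ->
  0 <= \sum_n (u n - q n) * ln ((q n + s * (u n - q n)) / v n).
Proof.
move=> v0 [qs qmin] us /andP[s0 s1] w0.
have ws : capped_simplex eps (fun n => q n + s * (u n - q n)).
  by apply: capped_simplex_convex => //; rewrite ltW.
have := qmin _ ws; rewrite /RE => opt.
rewrite -(pmulr_rge0 _ s0) mulr_sumr.
have tan : \sum_n (q n * ln ((q n + s * (u n - q n)) / v n)
    + (q n - (q n + s * (u n - q n)))) <= \sum_n q n * ln (q n / v n).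
  apply: ler_sum => n _; apply: entropy_tangent => //.
  by case: qs => _ /(_ n) /andP[].
rewrite big_split /= sumrB (proj1 qs) (proj1 ws) subrr addr0 in tan.
have := le_trans tan opt; rewrite -subr_ge0 -sumrB /= => h.
apply: le_trans h _; rewrite le_eqVlt; apply/orP; left; apply/eqP.
by apply: eq_bigr => n _; ring.
Qed.

(** If a coordinate of [q] vanished, moving slightly towards the uniform weights would contribute a
    term of order [ln s], unbounded below as [s] tends to 0, against the segment inequality. *)
Lemma RE_proj_gt0 (R : realType) (N : nat) (eps : R) (v q : 'I_N -> R) :
  (1 <= N)%N -> 0 <= eps < 1 -> (forall n, 0 < v n) -> is_RE_proj eps v q ->
  forall n, 0 < q n.
Proof.
move=> N1 he v0 hq k; have [[q1 qb] _] := hq.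
have q0 n : 0 <= q n by case/andP: (qb n).
rewrite lt_def q0 andbT; apply/eqP => qk.
have N0 : 0 < N%:R^-1 :> R by rewrite invr_gt0 ltr0n.
pose u (_ : 'I_N) : R := 1 / N%:R.
have u0 n : 0 < u n by rewrite /u div1r.
have us : capped_simplex eps u by apply: uniform_capped_simplex.
clearbody u.
pose K := \sum_n (u n - q n) * ln (u n / v n).
(* Chosen so that [u k * ln s = - (|K| + 1)], which outweighs [K]. *)
pose s := expR (- ((`|K| + 1) / u k)).
have s0 : 0 < s by apply: expR_gt0.
have K1 : 0 < (`|K| + 1) / u k by rewrite divr_gt0 // ltr_wpDl.
have s1 : s <= 1 by rewrite -expR0 ler_expR oppr_le0 ltW.
have w0 n : 0 < q n + s * (u n - q n).
  have -> : q n + s * (u n - q n) = (1 - s) * q n + s * u n by ring.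
  by rewrite ltr_wpDl ?mulr_gt0 // mulr_ge0 // subr_ge0.
have s01 : 0 < s <= 1 by rewrite s0.
have := RE_proj_segment _ _ _ s v q u v0 hq us s01 w0.
suff : \sum_n (u n - q n) * ln ((q n + s * (u n - q n)) / v n) <= K - (`|K| + 1).
  move=> h1 h2; have := le_trans h2 h1; have := ler_norm K; lra.
(* The segment point lies between [q n] and [u n]; the sign of [u n - q n] gives the same direction
   in both cases. *)
have mono n : (u n - q n) * ln ((q n + s * (u n - q n)) / v n) <=
    (u n - q n) * ln (u n / v n).
  have hs : 0 <= 1 - s by rewrite subr_ge0.
  have [hu|/ltW hu] := leP (q n) (u n).
    apply: ler_wpM2l; first by rewrite subr_ge0.
    rewrite ler_ln ?posrE ?divr_gt0 // ler_pM2r ?invr_gt0 //; nra.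
  apply: ler_wnM2l; first by rewrite subr_le0.
  rewrite ler_ln ?posrE ?divr_gt0 // ler_pM2r ?invr_gt0 //; nra.
rewrite /K (bigD1 k) //= [X in _ <= X - _](bigD1 k) //= qk add0r subr0.
rewrite -mulrA lnM ?posrE ?divr_gt0 // mulrDr /s expRK mulrN [u k * (_ / u k)]mulrC.
rewrite divfK ?gt_eqF // -/s [X in _ <= X]addrAC lerD //.
  by rewrite addrC.
exact: ler_sum.
Qed.

(** This is the segment inequality as [s] tends to 0, made quantitative: replacing the segment point
    by [q] inside the logarithm costs at most [s * C]. *)
Lemma RE_proj_first_order (R : realType) (N : nat) (eps : R) (v q u : 'I_N -> R) :
  (1 <= N)%N -> 0 <= eps < 1 -> (forall n, 0 < v n) -> is_RE_proj eps v q ->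
  capped_simplex eps u ->
  0 <= \sum_n (u n - q n) * ln (q n / v n).
Proof.
move=> N1 he v0 hq us; have q0 := RE_proj_gt0 _ _ _ v q N1 he v0 hq.
set L := \sum_n _; pose C := \sum_n 2 * (u n - q n) ^+ 2 / q n.
have u0 n : 0 <= u n by case: us => _ /(_ n) /andP[].
have C0 : 0 <= C.
  by apply: sumr_ge0 => n _; apply: divr_ge0;
    [apply: mulr_ge0; rewrite ?sqr_ge0 ?ler0n | exact: ltW].
have key s : 0 < s <= 1 / 2 -> 0 <= L + s * C.
  move=> /andP[s0 s1].
  (* This lower bound, used where [u n <= q n], is the source of the factor 2 in [C]. *)
  have w2 n : q n / 2 <= q n + s * (u n - q n).
    by have := q0 n; have := u0 n; nra.
  have w0 n : 0 < q n + s * (u n - q n) by apply: lt_le_trans (w2 n); rewrite divr_gt0.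
  have s01 : 0 < s <= 1 by rewrite s0; lra.
  apply: le_trans (RE_proj_segment _ _ _ s v q u v0 hq us s01 w0) _.
  rewrite /L /C mulr_sumr -big_split /=; apply: ler_sum => n _.
  set y := q n + s * (u n - q n); have y0 : 0 < y := w0 n.
  rewrite !ln_div ?posrE // mulrBr mulrBr addrAC lerD2r -lerBlDl -mulrBr.
  have qn := q0 n; have [hu|/ltW hu] := leP (q n) (u n).
    apply: (@le_trans _ _ ((u n - q n) * (s * (u n - q n) / q n))).
      apply: ler_wpM2l; first by rewrite subr_ge0.
      rewrite -ln_div ?posrE //; apply: le_trans (ln_le_subr1 _ _ (divr_gt0 y0 qn)) _.
      rewrite -[X in _ - X](divff (lt0r_neq0 qn)).
      by rewrite -mulrBl /y [q n + _]addrC addrK.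
    rewrite (_ : _ * (_ / _) = s * ((u n - q n) ^+ 2 / q n)); last by ring.
    rewrite ler_pM2l // ler_pM2r ?invr_gt0 //.
    by rewrite ler_peMl ?sqr_ge0 // ler1n.
  apply: (@le_trans _ _ ((u n - q n) * (s * (u n - q n) / y))).
    apply: ler_wnM2l; first by rewrite subr_le0.
    rewrite -[X in _ <= X]opprB -ln_div ?posrE // lerNr.
    apply: le_trans (ln_le_subr1 _ _ (divr_gt0 qn y0)) _.
    rewrite -[X in _ - X](divff (lt0r_neq0 y0)) -mulrBl /y opprD addrA subrr add0r.
    by rewrite mulNr.
  rewrite (_ : _ * (_ / _) = s * ((u n - q n) ^+ 2 / y)); last by ring.
  rewrite ler_pM2l // [X in _ <= X](_ : _ = (u n - q n) ^+ 2 * (2 / q n)); last by ring.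
  rewrite ler_wpM2l ?sqr_ge0 //.
  rewrite -[2]invrK -invfM lef_pV2 ?posrE ?mulr_gt0 // ?invr_gt0 //.
  by rewrite mulrC; apply: w2.
rewrite leNgt; apply/negP => L0.
have D0 : 0 < C + 1 - 2 * L by lra.
(* The term [- 2 * L] in the denominator keeps this step at most [1 / 2], and makes [L + s * C]
   equal to [L * (1 - 2 * L) / (C + 1 - 2 * L)], which is negative. *)
have sle : 0 < - L / (C + 1 - 2 * L) <= 1 / 2.
  by rewrite divr_gt0 ?oppr_gt0 //= ler_pdivrMr //; lra.
have := key _ sle.
rewrite -[L in L + _](mulfK (lt0r_neq0 D0)) -mulrA [_ / _ * C]mulrAC mulrA -mulrDl.
rewrite pmulr_lge0 ?invr_gt0 //; nra.
Qed.

Lemma RE_sub (R : realType) (N : nat) (u w q : 'I_N -> R) :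
  (forall n, 0 <= u n) -> (forall n, 0 < w n) -> (forall n, 0 < q n) ->
  RE u w - RE u q = \sum_n u n * ln (q n / w n).
Proof.
move=> u0 w0 q0; rewrite /RE -sumrB; apply: eq_bigr => n _.
have := u0 n; rewrite le_eqVlt => /predU1P[<-|un]; first by rewrite !mul0r subr0.
by rewrite !ln_div ?posrE //; ring.
Qed.

Lemma RE_ge0 (R : realType) (N : nat) (u q : 'I_N -> R) :
  (forall n, 0 <= u n) -> (forall n, 0 < q n) -> \sum_n u n = \sum_n q n ->
  0 <= RE u q.
Proof.
move=> u0 q0 e; rewrite -(subrr (\sum_n q n)) -{1}e -sumrB /RE; apply: ler_sum => n _.
have := entropy_tangent _ _ _ _ (u0 n) (q0 n) (q0 n).
by rewrite divff ?gt_eqF // ln1 mulr0 add0r.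
Qed.

(** The cap bounds every ratio [u n / (1 / N)] by [1 / (1 - eps)], and [RE] averages the logarithms
    of these ratios under [u]. *)
Lemma RE_uniform_le (R : realType) (N : nat) (eps : R) (u : 'I_N -> R) :
  (1 <= N)%N -> 0 <= eps < 1 -> capped_simplex eps u ->
  RE u (fun=> 1 / N%:R) <= ln (1 / (1 - eps)).
Proof.
move=> N1 /andP[e0 e1] [u1 ub]; have N0 : 0 < N%:R :> R by rewrite ltr0n.
rewrite -[X in _ <= X]mul1r -[X in _ <= X * _]u1 mulr_suml /RE; apply: ler_sum => n _.
have /andP[+ uM] := ub n.
rewrite le_eqVlt => /predU1P[<-|un]; first by rewrite !mul0r.
apply: (ler_wpM2l (ltW un)); rewrite ler_ln ?posrE ?divr_gt0 ?subr_gt0 //.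
rewrite div1r invrK -ler_pdivlMr // -mulrA -invfM.
exact: uM.
Qed.

(** * One round of the weight player *)

(** The drop [RE u w - RE u q] splits into three sums: the first is nonnegative by optimality of
    [q], the second pays for the loss of [w], and the third is bounded below by
    [ln (1 - x) >= - (x + x ^+ 2)] with [x ^+ 2 <= b * x]. *)
Lemma MW_step (R : realType) (N : nat) (eps eta b : R) (w m q u : 'I_N -> R) :
  (1 <= N)%N -> 0 <= eps < 1 -> 0 < eta -> b <= 1 / 2 ->
  (forall n, 0 < w n) -> \sum_n w n = 1 ->
  (forall n, 0 <= eta * m n <= b) ->
  is_RE_proj eps (fun n => w n * (1 - eta * m n)) q -> capped_simplex eps u ->
  eta * (\sum_n w n * m n) + RE u q <=
  (1 + b) * (eta * \sum_n u n * m n) + RE u w.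
Proof.
move=> N1 he eta0 b2 w0 w1 hm hq us.
pose v n := w n * (1 - eta * m n).
have r0 n : 0 < 1 - eta * m n by case/andP: (hm n) => _ h; lra.
have v0 n : 0 < v n by rewrite mulr_gt0.
have q0 := RE_proj_gt0 _ _ _ v q N1 he v0 hq.
have u0 n : 0 <= u n by case: us => _ /(_ n) /andP[].
have fo := RE_proj_first_order _ _ _ v q u N1 he v0 hq us.
have hRE := RE_sub _ _ u w q u0 w0 q0.
(* The loss is exactly the mass by which [q] exceeds [v]. *)
have qv : eta * (\sum_n w n * m n) <= \sum_n q n * ln (q n / v n).
  apply: (@le_trans _ _ (\sum_n (q n - v n))).
    rewrite sumrB (proj1 (proj1 hq)) -w1 -sumrB mulr_sumr.
    by apply: ler_sum => n _; rewrite /v le_eqVlt; apply/orP; left; apply/eqP; ring.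
  apply: ler_sum => n _; have := entropy_tangent _ _ _ _ (ltW (q0 n)) (v0 n) (v0 n).
  by rewrite divff ?gt_eqF // ln1 mulr0 add0r.
have lnr : - ((1 + b) * (eta * \sum_n u n * m n)) <= \sum_n u n * ln (1 - eta * m n).
  rewrite !mulr_sumr -sumrN; apply: ler_sum => n _.
  have /andP[x0 xb] := hm n.
  have x2 : 0 <= eta * m n <= 1 / 2 by rewrite x0; lra.
  apply: le_trans (ler_wpM2l (u0 n) (ln1Bx_ge _ _ x2)).
  have -> : - ((1 + b) * (eta * (u n * m n))) = u n * - ((eta * m n) * (1 + b)) by ring.
  by apply: ler_wpM2l => //; rewrite lerN2; nra.
have split : \sum_n u n * ln (q n / w n) =
    \sum_n (u n - q n) * ln (q n / v n) + \sum_n q n * ln (q n / v n)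
    + \sum_n u n * ln (1 - eta * m n).
  rewrite -!big_split /=; apply: eq_bigr => n _.
  rewrite /v !ln_div ?posrE ?mulr_gt0 // lnM ?posrE //; ring.
rewrite split in hRE; lra.
Qed.

(** * Linearity of [Smat] and the potential of the matrix player *)

Lemma Smat_scale (R : realType) (N p : nat) (g : 'I_N -> 'cV[R]_p) (mu : 'cV[R]_p)
    (c : R) (w : 'I_N -> R) : c *: Smat g mu w = Smat g mu (fun n => c * w n).
Proof. by rewrite /Smat scaler_sumr; apply: eq_bigr => n _; rewrite scalerA. Qed.

Lemma Smat_sum (R : realType) (N p : nat) (g : 'I_N -> 'cV[R]_p) (mu : 'cV[R]_p)
    (w : nat -> 'I_N -> R) (i j : nat) :
  \sum_(i <= t < j) Smat g mu (w t) = Smat g mu (fun n => \sum_(i <= t < j) w t n).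
Proof.
rewrite /Smat exchange_big /=; apply: eq_bigr => n _.
by rewrite scaler_suml.
Qed.

Lemma Sbar_wbar (R : realType) (N p : nat) (g : 'I_N -> 'cV[R]_p) (mu : 'cV[R]_p)
    (T : nat) (w : nat -> 'I_N -> R) : Sbar g mu T w = Smat g mu (wbar T w).
Proof. by rewrite /Sbar /S_t Smat_sum Smat_scale. Qed.

(* Since the [k]-th Gibbs state already includes the [k]-th matrix, the gradient
   inequality at that state telescopes without any second-order error term. *)
Lemma ln_mxtrace_expm_sum_le (R : realType) (p : nat) (eta : R) (S L : nat -> 'M[R]_p)
    (k : nat) :
  (0 < p)%N -> (forall t, (S t)^T = S t) ->
  (forall j, L j = eta *: \sum_(1 <= t < j.+1) S t) ->
  ln (\tr (expm (L k))) <=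
  ln p%:R + eta * \sum_(1 <= t < k.+1) frob (S t) ((\tr (expm (L t)))^-1 *: expm (L t)).
Proof.
move=> p0 sS LE.
have sL j : (L j)^T = L j.
  by rewrite LE linearZ /= linear_sum /=; congr (_ *: _); apply: eq_bigr.
elim: k => [|k IHk].
  have -> : L 0 = 1%:M^T *m diag_mx 0 *m 1%:M.
    by rewrite LE big_geq // scaler0 trmx1 mul1mx mulmx1 linear0.
  have UU : 1%:M *m 1%:M^T = 1%:M :> 'M[R]_p by rewrite trmx1 mulmx1.
  rewrite (expm_conj_diag _ _ _ _ UU) (mxtrace_conj_diag _ _ _ _ UU).
  rewrite [X in eta * X]big_geq // mulr0 addr0.
  rewrite (eq_bigr (fun=> 1)) => [|i _]; last by rewrite !mxE expR0.
  by rewrite sumr_const card_ord.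
rewrite big_nat_recr //= mulrDr addrA.
have := ln_mxtrace_expm_gradient _ _ _ _ p0 (sL k) (sL k.+1).
have -> : L k - L k.+1 = - (eta *: S k.+1).
  by rewrite !LE [X in _ - _ *: X]big_nat_recr //= scalerDr opprD addrA subrr add0r.
rewrite mulNmx -scalemxAl raddfN /= mxtraceZ /frob sS -scalemxAr mxtraceZ.
have := IHk; lra.
Qed.

(** * The game value and the analysis of a run *)

Section Run.
Variables (R : realType) (N p : nat) (eps : R) (g : 'I_N -> 'cV[R]_p) (mu : 'cV[R]_p).
Hypotheses (N1 : (1 <= N)%N) (p1 : (1 <= p)%N) (he : 0 <= eps < 1)
  (conv : in_conv g mu).

Lemma frob_Smat_density_ge0 (w : 'I_N -> R) (rho : 'M[R]_p) :
  (forall n, 0 <= w n) -> density rho -> 0 <= frob (Smat g mu w) rho.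
Proof.
move=> w0 [_ [psd _]]; rewrite frob_Smat sumr_ge0 // => n _.
by rewrite mulr_ge0.
Qed.

Lemma frob_Smat_density_le (w : 'I_N -> R) (rho : 'M[R]_p) :
  (forall n, 0 <= w n) -> \sum_n w n = 1 -> density rho ->
  frob (Smat g mu w) rho <= nu g.
Proof.
move=> w0 w1 hr; rewrite frob_Smat -[X in _ <= X]mul1r -w1 mulr_suml.
apply: ler_sum => n _; apply: ler_wpM2l => //.
exact: le_trans (density_quad_le _ _ _ _ hr) (sqr_dist_conv_le_nu _ _ _ _ _ n conv).
Qed.

Lemma density_nonempty : (@density R p !=set0)%classic.
Proof. by eexists; apply: (gibbs_density _ _ 0 p1 (trmx0 _ _ _)). Qed.

Definition game_value (u : 'I_N -> R) : R :=
  sup [set frob (Smat g mu u) rho | rho in @density R p].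

Lemma frob_le_game_value (u : 'I_N -> R) (rho : 'M[R]_p) :
  capped_simplex eps u -> density rho -> frob (Smat g mu u) rho <= game_value u.
Proof.
move=> [u1 ub] hr; have u0 n : 0 <= u n by case/andP: (ub n).
apply: ub_le_sup; last by exists rho.
(* A [sup] dominates its set only when the set is bounded above; [nu g] is such a bound. *)
by exists (nu g) => _ [r hr' <-]; apply: frob_Smat_density_le.
Qed.

Lemma game_value_ge0 (u : 'I_N -> R) : capped_simplex eps u -> 0 <= game_value u.
Proof.
move=> us; have [rho hr] := density_nonempty.
apply: le_trans (frob_le_game_value _ _ us hr).
by apply: frob_Smat_density_ge0 => // n; case: us => _ /(_ n) /andP[].
Qed.

(** Reduces a lower bound on the min-max value to a bound against each competitor [u]; the uniform
    weights make the infimum range over a nonempty set. *)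
Lemma le_OPT (x : R) :
  (forall u, capped_simplex eps u -> x <= game_value u) -> x <= OPT eps g mu.
Proof.
move=> h; apply: lb_le_inf.
  by exists (game_value (fun=> 1 / N%:R)), (fun=> 1 / N%:R) => //;
    apply: uniform_capped_simplex.
by move=> _ [u us <-]; apply: h.
Qed.

Lemma OPT_ge0 : 0 <= OPT eps g mu.
Proof. by apply: le_OPT => u us; apply: game_value_ge0. Qed.

(** Evaluating at the uniform weights suffices. This turns the multiplicative error of the first
    bound into the additive error of the second. *)
Lemma OPT_le_nu : OPT eps g mu <= nu g.
Proof.
have us := uniform_capped_simplex _ _ _ N1 he.
apply: (@le_trans _ _ (game_value (fun=> 1 / N%:R))).
  apply: ge_inf; last by exists (fun=> 1 / N%:R).
  by exists 0 => _ [u hu <-]; apply: game_value_ge0.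
have [rho hr] := density_nonempty.
apply: ge_sup; first by exists (frob (Smat g mu (fun=> 1 / N%:R)) rho), rho.
move=> _ [r hr' <-]; case: us => u1 ub.
by apply: frob_Smat_density_le => // n; case/andP: (ub n).
Qed.

Variables (eta_w eta_rho : R) (T : nat) (w : nat -> 'I_N -> R).
Hypotheses (T1 : (1 <= T)%N) (run : MW_run eps g mu eta_w eta_rho T w).
Hypotheses (rho0 : 0 < eta_rho) (w0 : 0 < eta_w) (wb : eta_w * nu g <= 1 / 2).

Lemma rho_t_density t : density (rho_t g mu eta_rho w t).
Proof.
apply: gibbs_density => //; rewrite linearZ /= linear_sum /=; congr (_ *: _).
by apply: eq_bigr => i _; apply: Smat_sym.
Qed.

Lemma eta_m_t_bound t n : 0 <= eta_w * m_t g mu eta_rho w t n <= eta_w * nu g.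
Proof.
have hr := rho_t_density t; apply/andP; split.
  by rewrite mulr_ge0 ?(ltW w0) //; case: hr => _ [psd _]; apply: psd.
rewrite ler_pM2l //.
exact: le_trans (density_quad_le _ _ _ _ hr) (sqr_dist_conv_le_nu _ _ _ _ _ n conv).
Qed.

(** Positivity propagates because [eta_w * nu g <= 1 / 2] keeps each factor [1 - eta_w * m] positive
    and the projection preserves positivity. The range reaches [T.+1], the output of the last
    projection. *)
Lemma MW_run_simplex t : (1 <= t <= T.+1)%N ->
  capped_simplex eps (w t) /\ forall n, 0 < w t n.
Proof.
have [w1 step] := run.
elim: t => // -[|t] IHt /andP[_ tT].
  rewrite (_ : w 1%N = (fun=> 1 / N%:R)); last exact/funext.
  split; first exact: uniform_capped_simplex.
  by move=> _; rewrite div1r invr_gt0 ltr0n.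
have tb : (1 <= t.+1 <= T)%N by [].
have [_ wt0] := IHt (ltnW tb).
have proj := step t.+1 tb; split; first by case: proj.
apply: (RE_proj_gt0 _ _ eps _ _ N1 he _ proj) => n; rewrite mulr_gt0 //.
have /andP[_ h] := eta_m_t_bound t.+1 n.
by rewrite subr_gt0 (le_lt_trans h) // (le_lt_trans wb) //; lra.
Qed.

(** The one-round inequality telescopes; the final relative entropy is dropped as nonnegative and
    the initial one is bounded by the cap. *)
Lemma MW_regret (u : 'I_N -> R) : capped_simplex eps u ->
  eta_w * \sum_(1 <= t < T.+1) frob (S_t g mu w t) (rho_t g mu eta_rho w t) <=
  (1 + eta_w * nu g) *
    (eta_w * \sum_(1 <= t < T.+1) frob (Smat g mu u) (rho_t g mu eta_rho w t))
  + ln (1 / (1 - eps)).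
Proof.
move=> us; have u0 n : 0 <= u n by case: us => _ /(_ n) /andP[].
have tele k : (k <= T)%N ->
  eta_w * \sum_(1 <= t < k.+1) frob (S_t g mu w t) (rho_t g mu eta_rho w t)
    + RE u (w k.+1) <=
  (1 + eta_w * nu g) *
    (eta_w * \sum_(1 <= t < k.+1) frob (Smat g mu u) (rho_t g mu eta_rho w t))
  + RE u (w 1%N).
  elim: k => [|k IHk] kT; first by rewrite !big_geq // !mulr0.
  have kb : (1 <= k.+1 <= T)%N by [].
  have [wk wk0] := MW_run_simplex k.+1 (leqW kT).
  have := MW_step _ _ eps eta_w (eta_w * nu g) (w k.+1) (m_t g mu eta_rho w k.+1)
    (w k.+2) u N1 he w0 wb wk0 (proj1 wk) (eta_m_t_bound k.+1)
    (proj2 run k.+1 kb) us.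
  rewrite ![\sum_(1 <= t < k.+2) _]big_nat_recr //= !mulrDr !frob_Smat.
  have := IHk (ltnW kT); lra.
have := tele T (leqnn T).
have [wT wT0] := MW_run_simplex T.+1 (leqnn _).
have : 0 <= RE u (w T.+1).
  by apply: RE_ge0 => //; rewrite (proj1 us) (proj1 wT).
have := RE_uniform_le _ _ _ _ N1 he us.
rewrite (_ : w 1%N = (fun=> 1 / N%:R)); last exact/funext/(proj1 run).
lra.
Qed.

Lemma opnorm_Sbar_le :
  opnorm (Sbar g mu T w) <=
  (1 + eta_w * nu g) * OPT eps g mu + ln (1 / (1 - eps)) / (T%:R * eta_w)
  + ln p%:R / (T%:R * eta_rho).
Proof.
have T0 : 0 < T%:R :> R by rewrite ltr0n.
have nu0 := nu_ge0 _ _ _ g.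
pose L := eta_rho *: \sum_(1 <= t < T.+1) S_t g mu w t.
have opL : opnorm (Sbar g mu T w) <= (T%:R * eta_rho)^-1 * ln (\tr (expm L)).
  have -> : Sbar g mu T w = (T%:R * eta_rho)^-1 *: L.
    by rewrite /L scalerA invfM -mulrA mulVf ?gt_eqF // mulr1.
  have LE : L = Smat g mu (fun n => eta_rho * \sum_(1 <= t < T.+1) w t n).
    by rewrite /L /S_t Smat_sum Smat_scale.
  apply: opnorm_le_ln_mxtrace_expm => //; first by rewrite LE Smat_sym.
    by rewrite invr_ge0 mulr_ge0 ?ltW.
  move=> x; rewrite LE; apply: Smat_quad_ge0 => n.
  rewrite mulr_ge0 ?(ltW rho0) // big_nat_cond sumr_ge0 // => t /andP[/andP[t1 tT] _].
  have tb : (1 <= t <= T.+1)%N by rewrite t1 ltnW.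
  by have [_ /(_ n) /ltW] := MW_run_simplex t tb.
set X := opnorm _ in opL *.
have := ln_mxtrace_expm_sum_le _ _ eta_rho (S_t g mu w) _ T p1
  (fun t => Smat_sym _ _ _ _ _ _) (fun=> erefl).
rewrite -/L => lnL.
set F := \sum_(1 <= t < T.+1) frob (S_t g mu w t) (rho_t g mu eta_rho w t).
have {}lnL : ln (\tr (expm L)) <= ln p%:R + eta_rho * F by exact: lnL.
set lp := ln p%:R in lnL *; set le := ln (1 / (1 - eps)).
set b := eta_w * nu g; have b0 : 0 < 1 + b by rewrite ltr_wpDr // mulr_ge0 // ltW.
pose c := le / (T%:R * eta_w) + lp / (T%:R * eta_rho).
(* Isolating [OPT] lets [le_OPT] replace it by the value at an arbitrary [u]. *)
suff h : (X - c) / (1 + b) <= OPT eps g mu.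
  by move: h; rewrite ler_pdivrMr // /c; lra.
apply: le_OPT => u us; rewrite ler_pdivrMr // lerBlDr /c.
have reg := MW_regret u us; rewrite -/F -/b -/le in reg.
have val : \sum_(1 <= t < T.+1) frob (Smat g mu u) (rho_t g mu eta_rho w t) <=
    T%:R * game_value u.
  apply: (@le_trans _ _ (\sum_(1 <= t < T.+1) game_value u)).
    by apply: ler_sum => t _; apply: frob_le_game_value => //; apply: rho_t_density.
  by rewrite sumr_const_nat subn1 /= mulr_natl.
have {}reg : eta_w * F <= (1 + b) * (eta_w * (T%:R * game_value u)) + le.
  apply: le_trans reg _; rewrite lerD2r (ler_pM2l b0) (ler_pM2l w0); exact: val.
have {}reg : F <= (1 + b) * (T%:R * game_value u) + le / eta_w.
  rewrite -(ler_pM2l w0); apply: le_trans reg _.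
  rewrite mulrDr [eta_w * (le / _)]mulrC divfK ?gt_eqF //.
  by rewrite lerD2r mulrCA.
apply: (le_trans opL); rewrite mulrC ler_pdivrMr ?mulr_gt0 //.
apply: (le_trans lnL).
rewrite [X in _ <= X](_ : _ =
    lp + eta_rho * ((1 + b) * (T%:R * game_value u) + le / eta_w)); last first.
  by field; rewrite !gt_eqF.
by rewrite lerD2l ler_pM2l.
Qed.

End Run.

Theorem mainTheorem6 (R : realType) (N p : nat) (eps : R)
  (g : 'I_N -> 'cV[R]_p) (mu : 'cV[R]_p)
  (eta_w eta_rho : R) (T : nat) (w : nat -> 'I_N -> R) :
  (1 <= N)%N -> (1 <= p)%N -> 0 <= eps < 1 -> (1 <= T)%N ->
  in_conv g mu ->
  MW_run eps g mu eta_w eta_rho T w ->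
  ((0 < eta_rho * nu g <= 1 / 2) -> (0 < eta_w * nu g <= 1 / 2) ->
     Sbar g mu T w = Smat g mu (wbar T w) /\
     opnorm (Sbar g mu T w) <=
       (1 + eta_rho * nu g) * (1 + eta_w * nu g) * OPT eps g mu
       + (1 + eta_rho * nu g) * ln (1 / (1 - eps)) / (T%:R * eta_w)
       + ln (p%:R) / (T%:R * eta_rho))
  /\
  (0 < nu g -> 0 < eps -> (2 <= p)%N ->
   eta_w = (nu g)^-1 * Num.sqrt (ln (1 / (1 - eps)) / T%:R) ->
   eta_rho = (nu g)^-1 * Num.sqrt (ln (p%:R) / T%:R) ->
   4 * Num.max (ln (1 / (1 - eps))) (ln (p%:R)) <= T%:R ->
   gammaw g mu (wbar T w) - OPT eps g mu <=
     4 * nu g * (Num.sqrt (ln (1 / (1 - eps)) / T%:R) + Num.sqrt (ln (p%:R) / T%:R))).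
Proof.
move=> N1 p1 he T1 conv run; have T0 : 0 < T%:R :> R by rewrite ltr0n.
have nu0 := nu_ge0 _ _ _ g.
have pos (x : R) : 0 < x * nu g -> 0 < x.
  by move=> h; rewrite ltNge; apply/negP => x0; have := mulr_le0_ge0 x0 nu0; lra.
have O0 := OPT_ge0 _ _ _ _ _ _ N1 p1 he conv.
have le0 : 0 <= ln (1 / (1 - eps)).
  by apply: ln_ge0; rewrite ler_pdivlMr; lra.
split.
  move=> /andP[r0 r1] /andP[w0 w1]; split; first exact: Sbar_wbar.
  have := opnorm_Sbar_le _ _ _ _ _ _ N1 p1 he conv _ _ _ _ T1 run
    (pos _ r0) (pos _ w0) w1.
  (* The factors [1 + eta_rho * nu g] are at least one and multiply nonnegative terms. *)
  move/le_trans; apply; rewrite lerD2r; apply: lerD.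
    rewrite -mulrA ler_peMl ?mulr_ge0 //; lra.
  rewrite -mulrA ler_peMl ?divr_ge0 ?mulr_ge0 ?(ltW T0) ?(ltW (pos _ w0)) //; lra.
move=> nup e0 p2 ew er hT.
have T0' := lt0r_neq0 T0; have nup' := lt0r_neq0 nup.
(* [T >= 4 * x] is what makes each product of step size and [nu g] at most [1 / 2]. *)
have sqrt_bound (x : R) : 0 < x -> 4 * x <= T%:R ->
    [/\ 0 < Num.sqrt (x / T%:R), Num.sqrt (x / T%:R) <= 1 / 2 &
      x = T%:R * Num.sqrt (x / T%:R) ^+ 2].
  move=> x0 xT; have xT0 : 0 < x / T%:R by rewrite divr_gt0.
  have sq : Num.sqrt (x / T%:R) ^+ 2 = x / T%:R by rewrite sqr_sqrtr // ltW.
  split; [by rewrite sqrtr_gt0| |by rewrite sq mulrC (divfK T0')].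
  rewrite -(ler_pXn2r (n := 2)) ?nnegrE ?sqrtr_ge0 ?divr_ge0 ?ler01 ?ler0n //.
  by rewrite sq ler_pdivrMr //; lra.
have ln_e : 0 < ln (1 / (1 - eps)) by apply: ln_gt0; rewrite ltr_pdivlMr; lra.
have ln_p : 0 < ln (p%:R : R) by apply: ln_gt0; rewrite ltr1n.
have hm1 : ln (1 / (1 - eps)) <= Num.max (ln (1 / (1 - eps))) (ln p%:R).
  by rewrite le_max lexx.
have hm2 : ln p%:R <= Num.max (ln (1 / (1 - eps))) (ln p%:R).
  by rewrite le_max lexx orbT.
have [|a0 a1 ae] := sqrt_bound _ ln_e; first by lra.
have [|b0 b1 be] := sqrt_bound _ ln_p; first by lra.
move: a0 a1 ae b0 b1 be ew er.
set a := Num.sqrt (_ / _); set b := Num.sqrt (_ / _) => a0 a1 ae b0 b1 be ew er.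
have ewn : eta_w * nu g = a by rewrite ew mulrC mulrA divff // mul1r.
have ern : eta_rho * nu g = b by rewrite er mulrC mulrA divff // mul1r.
have w0 : 0 < eta_w by apply: pos; rewrite ewn.
have r0 : 0 < eta_rho by apply: pos; rewrite ern.
have := opnorm_Sbar_le _ _ _ _ _ _ N1 p1 he conv _ _ _ _ T1 run r0 w0.
rewrite ewn => /(_ a1); rewrite Sbar_wbar -/(gammaw g mu _).
have -> : ln (1 / (1 - eps)) / (T%:R * eta_w) = nu g * a.
  by rewrite {1}ae ew; field; rewrite nup' T0' lt0r_neq0.
have -> : ln p%:R / (T%:R * eta_rho) = nu g * b.
  by rewrite {1}be er; field; rewrite nup' T0' lt0r_neq0.
(* The gap is now at most [a * nu g + a * nu g + b * nu g], which the constant 4 covers. *)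
have : a * OPT eps g mu <= a * nu g by rewrite ler_pM2l // OPT_le_nu.
have : 0 <= a * nu g by rewrite mulr_ge0 // ltW.
have : 0 <= b * nu g by rewrite mulr_ge0 // ltW.
rewrite mulrDr mulrDl mul1r [nu g * a]mulrC [nu g * b]mulrC -!mulrA.
rewrite [nu g * a]mulrC [nu g * b]mulrC; lra.
Qed.
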